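(* Let the $X_{ij}$, $i\in\{1,\dots,n\}$, $j\in\{1,\dots,p\}$, be i.i.d. Rademacher variables, i.e. $X_{ij}=1$ or $-1$ each with probability $1/2$, independent across $i$ and $j$. If $$\limsup_{n\to\infty}\big[(n\log n)^{-1/2}\log p\big]>0,$$ then $\tau_{n,\mathcal{A}^{\max}}\nrightarrow0$ as $n\to\infty$.
   Context: $p=p_n$ is a sequence of positive integers. $T_n=(T_{n1},\dots,T_{np})'$ with $T_{nj}=\sum_{i=1}^n X_{ij}\big/\sqrt{\sum_{i=1}^n X_{ij}^2}$. $Z$ is a standard Gaussian vector in $\mathbb{R}^p$ (mean $0$, identity covariance). $\mathcal{A}^{\max}=\{(-\infty,t]\times\cdots\times(-\infty,t]\subset\mathbb{R}^p: t\in\mathbb{R}\}$ and $\tau_{n,\mathcal{A}^{\max}}=\sup_{A\in\mathcal{A}^{\max}}|\mathbf{P}(T_n\in A)-\mathbf{P}(Z\in A)|$. *)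

(* Defs.v *)
From HB Require Import structures.
From mathcomp Require Import all_boot all_order all_algebra.
From mathcomp Require Import all_classical all_reals all_analysis.

Set Implicit Arguments.
Unset Strict Implicit.
Unset Printing Implicit Defensive.

Import Order.TTheory GRing.Theory Num.Theory.
Import numFieldNormedType.Exports.

Local Open Scope classical_set_scope.
Local Open Scope ring_scope.

Definition mutually_independent d (T : measurableType d) (R : realType)
    (P : probability T R) (I : finType) (X : I -> {RV P >-> R}) : Prop :=
  forall (J : {set I}) (B : I -> set R),
    (forall i, i \in J -> measurable (B i)) ->
    P (\bigcap_(i in [set` J]) (X i @^-1` B i)) =
    (\prod_(i in J) P (X i @^-1` B i))%E.

Definition rademacher d (T : measurableType d) (R : realType)
    (P : probability T R) (X : {RV P >-> R}) : Prop :=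
  P (X @^-1` [set 1]) = (2^-1)%:E /\ P (X @^-1` [set -1]) = (2^-1)%:E.

Definition iid_rademacher d (T : measurableType d) (R : realType)
    (P : probability T R) (n p : nat)
    (X : 'I_n -> 'I_p -> {RV P >-> R}) : Prop :=
  mutually_independent (fun ij : 'I_n * 'I_p => X ij.1 ij.2) /\
  forall i j, rademacher (X i j).

(* The coordinates are independent N(0, 1) variables, i.e. Z ~ N(0, I_p);
   [normal_prob m s] takes the standard deviation [s] as second parameter. *)
Definition standard_gaussian_vector d (T : measurableType d) (R : realType)
    (P : probability T R) (p : nat) (Z : 'I_p -> {RV P >-> R}) : Prop :=
  mutually_independent Z /\
  forall j (B : set R), measurable B ->
    distribution P (Z j) B = normal_prob 0 1 B.

Definition random_row (T : Type) (R : realType) (p : nat)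
    (Z : 'I_p -> T -> R) (w : T) : 'rV[R]_p := \row_j Z j w.

(* Since [x / 0 = 0], the statistic is 0 where all the X_ij, i < n, vanish. *)
Definition self_normalized_sum (T : Type) (R : realType) (n p : nat)
    (X : 'I_n -> 'I_p -> T -> R) (w : T) : 'rV[R]_p :=
  \row_j ((\sum_(i < n) X i j w) / Num.sqrt (\sum_(i < n) X i j w ^+ 2)).

Definition max_sets (R : realType) (p : nat) : set (set 'rV[R]_p) :=
  [set A | exists t : R, A = [set x : 'rV[R]_p | forall j, x ord0 j <= t]].
Arguments max_sets : clear implicits.

Definition gauss_approx_error d d' (T : measurableType d)
    (T' : measurableType d') (R : realType) (P : probability T R)
    (Q : probability T' R) (p : nat) (calA : set (set 'rV[R]_p))
    (S : T -> 'rV[R]_p) (Z : T' -> 'rV[R]_p) : \bar R :=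
  ereal_sup [set `|P (S @^-1` A) - Q (Z @^-1` A)|%E | A in calA].

(* Main.v *)
(* Up to a null set T_nj is a normalised sum of n signs, a lattice variable whose
   upper tail at t is at most C / t * exp (- t^2 / 2 - t^4 / (96 n)): the ratio
   C(n, m + 1) / C(n, m) equals (1 - y) / (1 + y) with y = (2m + 1 - n) / (n + 1),
   and its cubic term in y produces the quartic correction.  The Gaussian tail is
   at least c / t * exp (- t^2 / 2).  At the level t where p times the latter
   equals 1, P(max_j Z_j <= t) <= 1/e, whereas a union bound gives
   P(max_j T_nj <= t) >= 1 - C / c * exp (- t^4 / (96 n)).  Since t^2 >= log p + O(1),
   the last term is at most 1/4 as soon as log p >= M sqrt n for a suitable
   constant M, and the assumption provides this for infinitely many n. *)

Require Import Defs.
From mathcomp Require Import all_boot all_order all_algebra.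
From mathcomp Require Import all_classical all_reals all_analysis.
From mathcomp Require Import ring lra zify measurable_realfun.

Import Order.TTheory GRing.Theory Num.Theory.
Import numFieldNormedType.Exports.

Local Open Scope classical_set_scope.
Local Open Scope ring_scope.

Set Implicit Arguments.
Unset Strict Implicit.
Unset Printing Implicit Defensive.

(** * Exponential bound for the ratio (1 - y) / (1 + y) *)

(** The left side is the start of the power series of 2 artanh y. The difference of the two sides
    vanishes at 0 and has derivative 2 z^4 / ((1 + z) (1 - z)) >= 0. *)
Lemma artanh_ge_cubic (R : realType) (y : R) : 0 <= y < 1 ->
  2 * y + 2 / 3 * y ^+ 3 <= ln (1 + y) - ln (1 - y).
Proof.
move=> /andP[y0 y1].
pose f := fun z : R => ln (1 + z) - ln (1 - z) - (2 * z + 2 / 3 * z ^+ 3).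
pose f' := fun z : R => (1 + z)^-1 + (1 - z)^-1 - (2 + 2 * z ^+ 2).
have fd (z : R) : -1 < z < 1 -> is_derive z 1 f (f' z).
  move=> /andP[z1 z2].
  have dp : is_derive (1 + z) 1 (@ln R) (1 + z)^-1.
    by apply: is_derive1_ln; lra.
  have dm : is_derive (1 - z) 1 (@ln R) (1 - z)^-1.
    by apply: is_derive1_ln; lra.
  have dp' : is_derive z 1 (fun x : R => ln (1 + x)) (1 + z)^-1.
    apply: is_derive_eq. by rewrite /GRing.scale /=; ring.
  have dm' : is_derive z 1 (fun x : R => ln (1 - x)) (- (1 - z)^-1).
    apply: is_derive_eq. by rewrite /GRing.scale /=; ring.
  rewrite /f /f'; apply: is_derive_eq.
  rewrite /GRing.scale /=; field; apply/andP; split; apply/eqP => ?; lra.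
have : f 0 <= f y.
  apply: (@ger0_derive1_ndecr _ f 0 y) => // [z|z|].
  - rewrite in_itv /= => /andP[z0 zy].
    by apply: ex_derive; apply: fd; apply/andP; split; lra.
  - rewrite in_itv /= => /andP[z0 zy].
    have zz : -1 < z < 1 by apply/andP; split; lra.
    rewrite derive1E (@derive_val _ _ _ _ _ _ _ (fd z zz)) /f'.
    have -> : (1 + z)^-1 + (1 - z)^-1 - (2 + 2 * z ^+ 2) =
              2 * z ^+ 4 / ((1 + z) * (1 - z)).
      by field; apply/andP; split; apply/eqP => ?; lra.
    by apply: divr_ge0; [rewrite mulr_ge0 // exprn_ge0; lra | apply: mulr_ge0; lra].
  - apply: derivable_within_continuous => z.
    rewrite in_itv /= => /andP[z0 zy].
    by apply: ex_derive; apply: fd; apply/andP; split; lra.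
rewrite /f addr0 subr0 expr0n /= !mulr0; lra.
Qed.

Lemma one_sub_le_exp_cubic (R : realType) (y : R) : 0 <= y <= 1 ->
  1 - y <= (1 + y) * expR (- (2 * y + 2 / 3 * y ^+ 3)).
Proof.
move=> /andP[y0]; rewrite le_eqVlt => /predU1P[->|y1].
  (* The case y = 1 is apart, because the logarithm of 1 - y is meaningful only for y < 1; here the
     left side is 0. *)
  by rewrite subrr mulr_ge0 ?expR_ge0.
have /artanh_ge_cubic h : 0 <= y < 1 by rewrite y0.
have <- : (1 + y) * expR (ln (1 - y) - ln (1 + y)) = 1 - y.
  by rewrite expRB !lnK ?posrE; [field; apply/eqP => ?; lra | lra | lra].
by rewrite ler_pM2l; [rewrite ler_expR; lra | lra].
Qed.


(** * Binomial coefficients and binomial tails *)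

(** For even n = 2m, induction on m with (m+1) C(2m+2, m+1) = 2 (2m+1) C(2m, m) works because (2m+1)
    (2m+3) <= (2m+2)^2. The odd case n = 2m+1 follows from the even case m+1, since C(2m+2, m+1) = 2
    C(2m+1, m). *)
Lemma central_binomial_sq_le (n : nat) : ('C(n, n./2) ^ 2 * n.+1 <= 4 ^ n)%N.
Proof.
have C2S m : 'C(m.+1.*2, m.+1) = (2 * 'C(m.*2.+1, m))%N.
  rewrite doubleS binS -(@bin_sub m.*2.+1 m.+1); last by lia.
  by rewrite (_ : m.*2.+1 - m.+1 = m)%N; lia.
have even m : ('C(m.*2, m) ^ 2 * m.*2.+1 <= 4 ^ m.*2)%N.
  elim: m => [|m IH]; first by rewrite bin0.
  have e : (m.+1 * 'C(m.+1.*2, m.+1) = 2 * (m.*2.+1 * 'C(m.*2, m)))%N.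
    rewrite (mul_bin_diag m.*2.+1) C2S.
    rewrite -(@bin_sub m.*2.+1 m.+1); last by lia.
    by rewrite (_ : m.*2.+1 - m.+1 = m)%N; lia.
  rewrite -(@leq_pmul2l (m.+1 ^ 2)) // mulnA -expnMn e.
  have -> : (4 ^ m.+1.*2 = 16 * 4 ^ m.*2)%N by rewrite doubleS !expnS; lia.
  move: IH; move: ('C(_, _)) (4 ^ _)%N => c q IH.
  have : (4 * m.*2.+1 * (m.+1.*2.+1) * (c ^ 2 * m.*2.+1)
          <= 4 * m.*2.+1 * (m.+1.*2.+1) * q)%N by rewrite leq_mul2l IH orbT.
  nia.
have [m [->|->]] : exists m, n = m.*2 \/ n = m.*2.+1.
  by exists n./2; have := odd_double_half n; case: (odd n); lia.
  by rewrite doubleK.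
rewrite (half_bit_double m true : m.*2.+1./2 = m).
have := even m.+1; rewrite C2S doubleS [(4 ^ m.*2.+2)%N]expnS.
move: ('C(_, _)) (4 ^ _)%N => c q; nia.
Qed.

(* Up to a constant, the sum of 2 y + 2/3 y^3, y = (j + 1) / (n + 1), over j < k in
   steps of 2; here k = 2m - n when applied to C(n, m). *)
Definition decay_exponent (R : realType) (n k : R) : R :=
  k ^+ 2 / (2 * (n + 1)) + (k ^+ 4 - 2 * k ^+ 2) / (12 * (n + 1) ^+ 3).

Lemma decay_exponent_step (R : realType) (n k : R) : 0 <= n ->
  let y := (k + 1) / (n + 1) in
  decay_exponent n (k + 2) - decay_exponent n k = 2 * y + 2 / 3 * y ^+ 3.
Proof. by move=> n0 /=; rewrite /decay_exponent; field; apply/eqP => ?; lra. Qed.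

(** With k = 2m - n and y = (k+1) / (n+1), the ratio C(n, m+1) / C(n, m) is (1 - y) / (1 + y), and
    the increment of [decay_exponent] from k to k + 2 is exactly the exponent in
    [one_sub_le_exp_cubic]. The hypothesis says y >= 0. *)
Lemma binomial_step (R : realType) (n m : nat) : (n <= m.*2.+1)%N ->
  ('C(n, m.+1)%:R : R) * expR (decay_exponent n%:R (m.+1.*2%:R - n%:R)) <=
  'C(n, m)%:R * expR (decay_exponent n%:R (m.*2%:R - n%:R)).
Proof.
move=> nm; have [mn|nm'] := leqP m n; last first.
  by rewrite !bin_small ?mul0r //; lia.
set k : R := m.*2%:R - n%:R.
have -> : (m.+1.*2%:R : R) - n%:R = k + 2 by rewrite /k doubleS -addn2 natrD; ring.
set y : R := (k + 1) / (n%:R + 1).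
have n0 : 0 <= n%:R :> R by [].
have k1 : 0 <= k + 1.
  by rewrite /k; move: nm; rewrite -(ler_nat R) -addn1 natrD; lra.
have k2 : k + 1 <= n%:R + 1.
  by rewrite /k; move: mn; rewrite -(ler_nat R) -muln2 natrM; lra.
have y01 : 0 <= y <= 1.
  by rewrite /y divr_ge0 //= ?ler_pdivrMr ?mul1r; lra.
have e : ('C(n, m.+1)%:R : R) * (1 + y) = 'C(n, m)%:R * (1 - y).
  have := congr1 (fun z => z%:R : R) (mul_bin_left n m).
  rewrite /= !natrM natrB // -addn1 natrD => h.
  have ya : 1 + y = 2 * (m%:R + 1) / (n%:R + 1).
    by rewrite /y /k -muln2 natrM; field; apply/eqP => ?; lra.
  have yb : 1 - y = 2 * (n%:R - m%:R) / (n%:R + 1).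
    by rewrite /y /k -muln2 natrM; field; apply/eqP => ?; lra.
  by rewrite ya yb !mulrA; congr (_ / _); lra.
have -> : decay_exponent n%:R (k + 2) =
    decay_exponent n%:R k + (2 * y + 2 / 3 * y ^+ 3).
  by rewrite -decay_exponent_step //; ring.
rewrite expRD mulrCA mulrC ler_pM2r ?expR_gt0 //.
have y1 : 0 < 1 + y by lra.
rewrite -(ler_pM2r y1) mulrAC e -[leLHS]mulrA; apply: ler_wpM2l => //.
rewrite -(ler_pM2r (expR_gt0 (- (2 * y + 2 / 3 * y ^+ 3)))) -[leLHS]mulrA -expRD subrr.
rewrite expR0 mulr1; exact: one_sub_le_exp_cubic.
Qed.

(** Induction outward from the centre: [central_binomial_sq_le] gives the prefactor at [n./2], and
    [binomial_step] propagates the bound. The 1 in the exponent absorbs the value of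
    [decay_exponent] at the starting point. *)
Lemma binomial_le_gauss (R : realType) (n m : nat) : (n./2 <= m)%N ->
  ('C(n, m)%:R : R) <= 2 ^+ n / Num.sqrt (n%:R + 1) *
    expR (1 - decay_exponent n%:R (m.*2%:R - n%:R)).
Proof.
move=> nm; rewrite expRD expRN mulrA ler_pdivlMr ?expR_gt0 //.
have n0 : 0 <= n%:R :> R by [].
have c0 : ('C(n, n./2)%:R : R) <= 2 ^+ n / Num.sqrt (n%:R + 1).
  rewrite ler_pdivlMr ?sqrtr_gt0; last lra.
  rewrite -ler_sqr ?nnegrE ?mulr_ge0 ?exprn_ge0 ?sqrtr_ge0 //.
  rewrite exprMn sqr_sqrtr; last lra.
  rewrite -exprM mulnC exprM natr1 -!natrX -natrM ler_nat.
  rewrite -[(2 ^ 2)%N]/4%N. exact: central_binomial_sq_le.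
(* The starting argument is 0 for even n and -1 for odd n. *)
have e0 : decay_exponent n%:R (n./2.*2%:R - n%:R) <= 1 :> R.
  have -> : (n./2.*2%:R : R) - n%:R = - (odd n)%:R.
    have : n%:R = (odd n)%:R + n./2.*2%:R :> R by rewrite -natrD odd_double_half.
    lra.
  rewrite /decay_exponent; case: (odd n) => /=; last first.
    by rewrite oppr0 !expr0n /= mulr0 subr0 !mul0r addr0.
  rewrite sqrrN (_ : (-1) ^+ 4 = 1 :> R) ?expr1n; last by ring.
  have h1 : 1 / (2 * (n%:R + 1)) <= 1 :> R by rewrite ler_pdivrMr; lra.
  have h2 : 0 <= ((12 * (n%:R + 1) ^+ 3)^-1 : R).
    by rewrite invr_ge0 mulr_ge0 // exprn_ge0; lra.
  by rewrite (_ : 1 - 2 * 1 = -1 :> R) ?mulN1r; lra.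
elim: m nm => [|m IH].
 rewrite leqn0 => /eqP h; rewrite -{1 2}h.
  by apply: ler_pM => //; rewrite ?expR_ge0 ?ler_expR.
rewrite leq_eqVlt => /predU1P[<-|nm].
  by apply: ler_pM => //; rewrite ?expR_ge0 ?ler_expR.
apply: le_trans (IH nm); apply: binomial_step.
move: nm (odd_double_half n); move: (n./2) (odd n) => h b; case: b; lia.
Qed.

(** Beyond m, consecutive coefficients have ratio at most r = (n - m) / (m + 1), and the geometric
    series sums to 1 / (1 - r) = (m + 1) / (2m + 1 - n). The proof clears denominators and descends
    from m = n. *)
Lemma binomial_tail_geometric (n m : nat) : (n <= m.*2)%N -> (m <= n)%N ->
  ((\sum_(m <= i < n.+1) 'C(n, i)) * (m.*2.+1 - n) <= 'C(n, m) * m.+1)%N.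
Proof.
move=> nm; move e : (n - m)%N => d; elim: d m e nm => [|d IH] m e nm mn.
  have -> : m = n by lia.
  by rewrite big_nat1 binn; lia.
rewrite big_ltn; last by lia.
have := IH m.+1; have := mul_bin_left n m.
move: (\sum_(_ <= _ < _) _)%N => S; move: ('C(n, _)) ('C(n, m)) => c' c.
move=> h1 h2; have {h2} := h2 ltac:(lia) ltac:(lia) ltac:(lia) => h2.
have {h2} [a ea h2] : exists2 a, (m.*2.+1 = n + a)%N & (S * a.+2 <= c' * m.+2)%N.
  exists (m.*2.+1 - n)%N; first lia.
  by rewrite (_ : (m.*2.+1 - n).+2 = m.+1.*2.+1 - n)%N //; lia.
rewrite (_ : m.*2.+1 - n = a)%N; last by lia.
have {}h1 : (c * a + m.+1 * c' = c * m.+1)%N.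
  by rewrite h1 mulnC -mulnDl [RHS]mulnC; congr (_ * _)%N; lia.
(* After cancelling [c * a], the bound at [m.+1] leaves (m+2) a <= (m+1) (a+2), that is a <= 2m+2,
   which holds as a = 2m+1-n. *)
rewrite mulnDl -h1 leq_add2l -(@leq_pmul2r a.+2) // mulnAC.
apply: leq_trans (_ : c' * m.+2 * a <= _)%N; first by rewrite leq_mul2r h2 orbT.
rewrite [leqRHS]mulnAC [leqRHS]mulnC -!mulnA leq_mul2l; apply/orP; right; nia.
Qed.

(** The hypotheses force t^2 <= n, so passing from n + 1 to n costs at most 1/2 in the quadratic
    term. In the quartic term (n+1)^3 <= 8 n^3 gives 96 = 12 * 8, and the negative term costs at
    most 1/6. *)
Lemma decay_exponent_ge (R : realType) (n k t : R) : 1 <= n -> 0 <= t ->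
  Num.sqrt n * t <= k -> k <= n ->
  t ^+ 2 / 2 + t ^+ 4 / (96 * n) - 1 <= decay_exponent n k.
Proof.
move=> n1 t0 tk kn.
have k0 : 0 <= k by apply: le_trans tk; rewrite mulr_ge0 ?sqrtr_ge0.
have k2n : k ^+ 2 <= n ^+ 2 by rewrite ler_sqr ?nnegrE; lra.
have t2k : n * t ^+ 2 <= k ^+ 2.
  rewrite -[n in n * _]sqr_sqrtr; last lra.
  by rewrite -exprMn ler_sqr ?nnegrE // mulr_ge0 ?sqrtr_ge0.
have t4k : n ^+ 2 * t ^+ 4 <= k ^+ 4.
  rewrite (_ : n ^+ 2 * t ^+ 4 = (n * t ^+ 2) ^+ 2); last by ring.
  rewrite (_ : k ^+ 4 = (k ^+ 2) ^+ 2); last by ring.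
  by rewrite ler_sqr ?nnegrE ?mulr_ge0 ?sqr_ge0 //; lra.
have e1 : t ^+ 2 / 2 - 1 / 2 <= k ^+ 2 / (2 * (n + 1)).
  rewrite ler_pdivlMr; last lra.
  have : t ^+ 2 <= n by rewrite -(@ler_pM2l _ n); [rewrite -expr2; lra | lra].
  nra.
have N3 : 0 < (n + 1) ^+ 3 by rewrite exprn_gt0; lra.
have D3 : 0 < 12 * (n + 1) ^+ 3 by lra.
have N3n : (n + 1) ^+ 3 <= 8 * n ^+ 3.
  rewrite (_ : 8 * n ^+ 3 = (2 * n) ^+ 3); last by ring.
  by rewrite ler_pXn2r ?nnegrE //; lra.
have e2 : t ^+ 4 / (96 * n) <= k ^+ 4 / (12 * (n + 1) ^+ 3).
  rewrite (ler_pdivlMr _ _ D3) mulrAC ler_pdivrMr; last lra.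
  apply: le_trans (_ : t ^+ 4 * (96 * n ^+ 3) <= _).
    by rewrite ler_wpM2l ?exprn_ge0 //; lra.
  rewrite (_ : _ * _ = n ^+ 2 * t ^+ 4 * (96 * n)); last by ring.
  by rewrite ler_wpM2r //; lra.
have e3 : 2 * k ^+ 2 / (12 * (n + 1) ^+ 3) <= 1 / 6.
  rewrite (ler_pdivrMr _ _ D3).
  have : n ^+ 2 <= (n + 1) ^+ 3.
    rewrite (_ : (n + 1) ^+ 3 = n ^+ 2 + (n ^+ 3 + 2 * n ^+ 2 + 3 * n + 1)); last by ring.
    by rewrite lerDl !addr_ge0 ?mulr_ge0 ?exprn_ge0; lra.
  lra.
rewrite /decay_exponent mulrBl; lra.
Qed.

(** Multiplying the bound on C(n, m) by the geometric factor (m+1) / (k+1) leaves sqrt(n+1) / (k+1)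
    <= 2 / t, because k >= t sqrt n. The 2 in the exponent collects the 1 of [binomial_le_gauss] and
    the 1 of [decay_exponent_ge]. *)
Lemma binomial_tail_le_gauss (R : realType) (n m : nat) (t : R) :
    (0 < n)%N -> (m <= n)%N -> 0 < t -> Num.sqrt n%:R * t <= m.*2%:R - n%:R ->
  (\sum_(m <= i < n.+1) 'C(n, i))%:R / 2 ^+ n <=
  2 / t * expR (2 - t ^+ 2 / 2 - t ^+ 4 / (96 * n%:R)).
Proof.
move=> n0 mn t0; set k : R := m.*2%:R - n%:R => tk.
have n1 : 1 <= n%:R :> R by rewrite ler1n.
have sn : 0 < Num.sqrt n%:R :> R by rewrite sqrtr_gt0; lra.
have k0 : 0 < k by apply: lt_le_trans tk; rewrite mulr_gt0.
have nm : (n <= m.*2)%N by rewrite -(ler_nat R); move: k0; rewrite /k; lra.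
have kn : k <= n%:R.
  by rewrite /k -muln2 natrM; move: mn; rewrite -(ler_nat R); lra.
have := binomial_tail_geometric nm mn; rewrite -(ler_nat R) !natrM.
rewrite natrB -1?natr1; last by rewrite leqW.
set S := (\sum_(_ <= _ < _) _)%N.
rewrite (_ : m.*2%:R + 1 - n%:R = k + 1) => [hS|]; last by rewrite /k; ring.
have s1 : 0 < Num.sqrt (n%:R + 1) :> R by rewrite sqrtr_gt0; lra.
have hC := @binomial_le_gauss R n m.
have {hC}/hC : (n./2 <= m)%N.
  by rewrite -leq_double; apply: leq_trans nm; have := odd_double_half n; lia.
rewrite -/k; set E := decay_exponent _ _ => hC.
have hE := decay_exponent_ge n1 (ltW t0) tk kn; rewrite -/E in hE.
set Q := (X in expR X).
have eE : expR (1 - E) <= expR Q by rewrite ler_expR /Q; lra.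
rewrite ler_pdivrMr ?exprn_gt0 // -(@ler_pM2r _ (k + 1)); last lra.
apply: le_trans hS _.
apply: le_trans (_ : 2 ^+ n / Num.sqrt (n%:R + 1) * expR Q * (n%:R + 1) <= _).
  apply: ler_pM => //.
    by apply: (le_trans hC); rewrite ler_wpM2l // divr_ge0 ?exprn_ge0 ?ltW.
  by rewrite natr1 ler_nat.
have -> : 2 ^+ n / Num.sqrt (n%:R + 1) * expR Q * (n%:R + 1) =
    2 ^+ n * expR Q * Num.sqrt (n%:R + 1).
  rewrite -[in X in _ * X = _](@sqr_sqrtr _ (n%:R + 1)); last lra.
  by field; rewrite gt_eqF.
have -> : 2 / t * expR Q * 2 ^+ n * (k + 1) =
   2 ^+ n * expR Q * (2 * (k + 1) / t) by ring.
rewrite ler_wpM2l ?mulr_ge0 ?exprn_ge0 ?expR_ge0 // ler_pdivlMr //.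
have : Num.sqrt (n%:R + 1) <= 2 * Num.sqrt n%:R :> R.
  rewrite -ler_sqr ?nnegrE ?mulr_ge0 ?sqrtr_ge0 // exprMn !sqr_sqrtr; lra.
move: tk t0; clear; nra.
Qed.

(** * Counting sign patterns *)

Lemma card_sets_ge (n m : nat) :
  #|[set A : {set 'I_n} | (m <= #|A|)%N]%SET| = (\sum_(m <= i < n.+1) 'C(n, i))%N.
Proof.
rewrite -sum1_card (partition_big (fun B : {set 'I_n} => inord #|B| : 'I_n.+1)
  (fun i : 'I_n.+1 => m <= i)%N) /=; last first.
  by move=> A; rewrite inE inordK // ltnS -[leqRHS](card_ord n) max_card.
rewrite (big_nat_widenl _ 0%N) // big_mkord; apply: eq_big => i // mi.
have := card_draws 'I_n i; rewrite card_ord => <-.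
rewrite -sum1_card; apply: eq_bigl => A.
rewrite !inE -val_eqE /= inordK; last first.
  by rewrite ltnS -[leqRHS](card_ord n) max_card.
by case: eqP => [->|]; rewrite ?mi ?andbF.
Qed.

(** A set A stands for the positions of the signs +1, so that the signs sum to 2 |A| - n. Taking m
    as the least cardinality in the family turns the real threshold into an integer one without
    rounding. *)
Lemma sign_tail_le_gauss (R : realType) (n : nat) (t : R) : (0 < n)%N -> 0 < t ->
  #|[set A : {set 'I_n} | Num.sqrt n%:R * t < #|A|.*2%:R - n%:R]%SET|%:R / 2 ^+ n <=
  2 / t * expR (2 - t ^+ 2 / 2 - t ^+ 4 / (96 * n%:R)).
Proof.
move=> n0 t0; set F := [set A | _]%SET.
have [->|[A0 A0F]] := set_0Vmem F.
  by rewrite cards0 mul0r mulr_ge0 ?expR_ge0 // divr_ge0 // ltW.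
case: (arg_minnP (fun A : {set 'I_n} => #|A|) A0F) => A AF Amin.
apply: le_trans (@binomial_tail_le_gauss R n #|A| t n0 _ t0 _).
- rewrite -card_sets_ge ler_wpM2r ?invr_ge0 ?exprn_ge0 // ler_nat.
  apply: subset_leq_card; apply/fintype.subsetP => B BF.
  by rewrite inE Amin.
- by rewrite -[leqRHS](card_ord n) max_card.
- by have : A \in F := AF; rewrite inE => /ltW.
Qed.

(** * Lower bound for the Gaussian tail *)

Lemma measurable_set_gt (R : realType) (t : R) : measurable [set x : R | t < x].
Proof.
rewrite (_ : [set x | _] = `]t, +oo[%classic) //.
by apply/seteqP; split => x /=; rewrite in_itv /= andbT.
Qed.

(** Only the interval from t to t + 1/t is kept: its length is 1/t, and on it x^2 <= t^2 + 2 + 1/t^2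
    <= t^2 + 3 bounds the density from below. *)
Lemma gauss_tail_ge (R : realType) (t : R) : 1 <= t ->
  ((normal_peak 1 * expR (- (3 / 2)) / t * expR (- (t ^+ 2 / 2)))%:E <=
   normal_prob 0%R 1%R [set x : R | (t < x)%R])%E.
Proof.
move=> t1.
have t0 : 0 < t by lra.
have h : t <= t + t^-1 by rewrite lerDl invr_ge0 ltW.
have sub : `]t, (t + t^-1)]%classic `<=` [set x : R | t < x].
  by move=> x /=; rewrite in_itv /= => /andP[].
have mt := measurable_set_gt t.
apply: (@le_trans _ _ (normal_prob 0%R 1%R `]t, (t + t^-1)]%classic)); last first.
  by apply: le_measure => //; rewrite inE.
rewrite /normal_prob.
set c := (X in (X%:E <= _)%E).
pose v := normal_peak 1 * expR (- (3 / 2)) * expR (- (t ^+ 2 / 2)) : R.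
have -> : (c%:E = \int[lebesgue_measure]_(x in `]t, (t + t^-1)%R]) v%:E)%E.
  rewrite integral_cst //= lebesgue_measure_itv /= lte_fin ltrDl invr_gt0 t0.
  by rewrite -EFinB -EFinM; congr EFin; rewrite /c /v; ring.
have v0 : 0 <= v by rewrite /v !mulr_ge0 ?normal_peak_ge0 ?expR_ge0.
apply: ge0_le_integral => //=.
- by apply/measurable_EFinP; apply: measurable_funTS; apply: measurable_normal_pdf.
- move=> x; rewrite in_itv /= => /andP[tx xt]; rewrite lee_fin.
  rewrite normal_pdfE ?oner_neq0 // /v -mulrA -expRD ler_wpM2l ?normal_peak_ge0 //.
  rewrite /normal_fun ler_expR subr0 expr1n.
  have : x ^+ 2 <= (t + t^-1) ^+ 2 by rewrite ler_sqr ?nnegrE; lra.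
  have -> : (t + t^-1) ^+ 2 = t ^+ 2 + 2 + t^-1 ^+ 2 by field; rewrite gt_eqF.
  have : t^-1 ^+ 2 <= 1 by rewrite expr_le1 // ?invr_ge0 ?invf_le1 //; lra.
  lra.
Qed.

(** * Union bound and self-normalised Rademacher sums *)

Lemma measure_bigcup_pred_le d (T : measurableType d) (R : realType)
    (P : probability T R) (I : finType) (A : {pred I}) (F : I -> set T) :
    (forall i, measurable (F i)) ->
  (P (\bigcup_(i in [set` A]) F i) <= \sum_(i in A) P (F i))%E.
Proof.
move=> mF; rewrite bigcup_pred.
suff [] : measurable (\big[setU/set0]_(i in A) F i) /\
  (P (\big[setU/set0]_(i in A) F i) <= \sum_(i in A) P (F i))%E by [].
apply: (big_ind2 (fun B x => measurable B /\ (P B <= x)%E)).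
- by rewrite measure0.
- move=> B x C y [mB Bx] [mC Cy]; split; first exact: measurableU.
  exact: le_trans (measureU2 _ mB mC) (leeD Bx Cy).
- by [].
Qed.

Lemma measurable_self_normalized_sum d (T : measurableType d) (R : realType)
    (P : probability T R) (n p : nat) (X : 'I_n -> 'I_p -> {RV P >-> R}) (j : 'I_p) :
  measurable_fun setT (fun w => self_normalized_sum (fun i j => X i j) w ord0 j).
Proof.
(* Dividing by the square root is rewritten as a real power; the two agree also where the sum of
   squares is 0, both factors being 0 there. *)
rewrite (_ : (fun w => _) = (fun w => (\sum_(i < n) X i j w) *
  (\sum_(i < n) X i j w ^+ 2) `^ (- 2^-1))); last first.
  apply/funext => w; rewrite mxE powRN powR12_sqrt //.
  by apply: sumr_ge0 => i _; rewrite sqr_ge0.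
apply: measurable_funM; first by apply: measurable_sum => i.
apply: (measurableT_comp (measurable_powR _)).
by apply: measurable_sum => i; apply: measurable_funX.
Qed.

Lemma measurable_self_normalized_sum_gt d (T : measurableType d) (R : realType)
    (P : probability T R) (n p : nat) (X : 'I_n -> 'I_p -> {RV P >-> R})
    (j : 'I_p) (t : R) :
  measurable [set w | (t < self_normalized_sum (fun i j => X i j) w ord0 j)%R].
Proof.
have := measurable_self_normalized_sum X j.
by move=> /(_ measurableT _ (measurable_set_gt t)); rewrite setTI.
Qed.

Lemma rademacher_column_pattern d (T : measurableType d) (R : realType)
    (P : probability T R) (n p : nat) (X : 'I_n -> 'I_p -> {RV P >-> R})
    (j : 'I_p) (A : {set 'I_n}) : iid_rademacher X ->
  P (\bigcap_(ij in [set` [set ij : 'I_n * 'I_p | ij.2 == j]%SET])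
       (X ij.1 ij.2 @^-1` [set if ij.1 \in A then 1 else -1])) = (2 ^- n)%:E.
Proof.
move=> [Xind Xrad].
rewrite (Xind _ (fun ij => [set if ij.1 \in A then 1 else -1])) //.
rewrite (eq_bigr (fun=> (2^-1)%:E)); last first.
  by move=> [i k] _ /=; case: (Xrad i k) => h1 h2; case: ifP.
rewrite prodEFin prodr_const exprVn; congr (_ ^- _)%:E.
rewrite (_ : [set _ | _]%SET = [set (i, j) | i in 'I_n]%SET).
  by rewrite card_imset ?card_ord // => x y [].
apply/setP => -[i k]; rewrite inE /=; apply/eqP/imsetP => [->|[x _ [_ ->//]]].
by exists i.
Qed.

Lemma sum_signs (R : realType) (n : nat) (A : {set 'I_n}) :
  \sum_(i < n) (if i \in A then 1 else -1) = #|A|.*2%:R - n%:R :> R.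
Proof.
rewrite (eq_bigr (fun i => (if i \in A then 2 else 0) - 1)); last first.
  by move=> i _; case: ifP => _; ring.
rewrite sumrB -big_mkcond /= !sumr_const card_ord -mulrnA -muln2.
by rewrite mulnC natrM.
Qed.

(** The laws fix the values only almost surely, so the event is covered by the null sets [N i],
    where an entry of column j is not a sign, and by the patterns [E A] of probability 2^-n. Off the
    null sets the sum of squares is n and the statistic is (2 |A| - n) / sqrt n. *)
Lemma self_normalized_tail_le d (T : measurableType d) (R : realType)
    (P : probability T R) (n p : nat) (X : 'I_n -> 'I_p -> {RV P >-> R})
    (j : 'I_p) (t : R) : (0 < n)%N -> iid_rademacher X ->
  (P [set w | (t < self_normalized_sum (fun i j => X i j) w ord0 j)%R] <=
   (#|[set A : {set 'I_n} | Num.sqrt n%:R * t < #|A|.*2%:R - n%:R]%SET|%:R / 2 ^+ n)%:E)%E.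
Proof.
move=> n0 Xiid; set F := [set A : {set 'I_n} | _]%SET.
pose E (A : {set 'I_n}) := \bigcap_(ij in [set` [set ij : 'I_n * 'I_p | ij.2 == j]%SET])
       (X ij.1 ij.2 @^-1` [set if ij.1 \in A then 1 else -1]).
pose N (i : 'I_n) := X i j @^-1` (~` ([set 1] `|` [set -1])).
have mE A : measurable (E A).
  apply: fin_bigcap_measurable => [|ij _]; first exact: finite_finset.
  exact: measurable_funPTI.
have mN i : measurable (N i).
  apply: measurable_funPTI.
  by apply: measurableC; apply: measurableU.
have N0 i : P (N i) = 0%E.
  have [h1 h2] := Xiid.2 i j.
  have m1 (a : R) : measurable (X i j @^-1` [set a]).
    exact: measurable_funPTI.
  rewrite /N -preimage_setC probability_setC; last first.
    by rewrite preimage_setU; apply: measurableU.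
  rewrite preimage_setU measureU //; last first.
    rewrite -preimage_setI (_ : _ `&` _ = set0) ?preimage_set0 //.
    by apply/seteqP; split=> x //= [->] h; have : (1 : R) = -1 := h; lra.
  have e : (1 - ((2^-1 : R)%:E + (2^-1 : R)%:E) = 0)%E.
    have h : 2^-1 + 2^-1 = 1 :> R by lra.
    by rewrite -EFinD h subrr.
  exact: etrans (congr2 (fun a b : \bar R => 1 - (a + b))%E h1 h2) e.
have sub : [set w | (t < self_normalized_sum (fun i j => X i j) w ord0 j)%R] `<=`
    (\bigcup_(A in [set` F]) E A) `|` (\bigcup_(i in [set` 'I_n]) N i).
  move=> w /= tw.
  have [[i wi]|wN] := pselect (exists i, N i w); first by right; exists i.
  left; pose A := [set i | X i j w == 1]%SET.
  have XA i : X i j w = if i \in A then 1 else -1.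
    rewrite inE; case: eqP => // h1.
    by apply: contrapT => h2; apply: wN; exists i => -[].
  exists A; last by move=> [i k]; rewrite /= inE /= => /eqP ->; rewrite XA.
  rewrite /= inE -sum_signs.
  move: tw; rewrite mxE (eq_bigr _ (fun i _ => XA i)).
  rewrite [X in _ / Num.sqrt X](_ : _ = n%:R).
    by rewrite ltr_pdivlMr ?sqrtr_gt0 ?ltr0n // mulrC.
  rewrite (eq_bigr (fun=> 1)) ?sumr_const ?card_ord // => i _.
  by rewrite XA; case: ifP => _; ring.
have mT := measurable_self_normalized_sum_gt X j t.
have mU1 : measurable (\bigcup_(A in [set` F]) E A).
  by apply: fin_bigcup_measurable => //; exact: finite_finset.
have mU2 : measurable (\bigcup_(i in [set` 'I_n]) N i).
  by apply: fin_bigcup_measurable => //; exact: finite_finset.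
apply: (le_trans (le_measure _ _ _ sub)); rewrite ?inE //.
  exact: measurableU.
apply: le_trans (measureU2 _ mU1 mU2) _.
rewrite -[leRHS]adde0; apply: leeD.
  apply: (le_trans (measure_bigcup_pred_le _ _ mE)).
  rewrite (eq_bigr (fun=> (2 ^- n)%:E)) => [|A _]; last exact: rademacher_column_pattern.
  by rewrite sumEFin sumr_const -[X in (X <= _)%E]/((2 ^- n *+ #|F|)%:E) mulr_natl.
apply: (le_trans (measure_bigcup_pred_le _ _ mN)).
by rewrite big1.
Qed.

Lemma rademacher_max_ge d (T : measurableType d) (R : realType)
    (P : probability T R) (n p : nat) (X : 'I_n -> 'I_p -> {RV P >-> R})
    (t : R) : (0 < n)%N -> 0 < t -> iid_rademacher X ->
  ((1 - p%:R * (2 / t * expR (2 - t ^+ 2 / 2 - t ^+ 4 / (96 * n%:R))))%:E <=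
   P (self_normalized_sum (fun i j => X i j) @^-1`
        [set x : 'rV[R]_p | forall j, (x ord0 j <= t)%R]))%E.
Proof.
move=> n0 t0 Xiid; set b := (X in p%:R * X).
pose G (j : 'I_p) := [set w | (t < self_normalized_sum (fun i j => X i j) w ord0 j)%R].
have mG j : measurable (G j) := measurable_self_normalized_sum_gt X j t.
have -> : self_normalized_sum (fun i j => X i j) @^-1`
    [set x : 'rV[R]_p | forall j, (x ord0 j <= t)%R] =
    ~` (\bigcup_(j in [set` 'I_p]) G j).
  apply/seteqP; split => w /= h.
    by move=> [j _]; rewrite /G /= ltNge h.
  by move=> j; rewrite leNgt; apply/negP => hj; apply: h; exists j.
rewrite probability_setC; last by apply: fin_bigcup_measurable.
rewrite EFinB; apply: leeB => //.
apply: (le_trans (measure_bigcup_pred_le _ _ mG)).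
apply: (@le_trans _ _ (\sum_(j in 'I_p) b%:E)%E).
  apply: lee_sum => j _; apply: (le_trans (self_normalized_tail_le _ _ n0 Xiid)).
  by rewrite lee_fin; exact: sign_tail_le_gauss.
by rewrite sumEFin sumr_const card_ord mulr_natl.
Qed.

(** * Upper bound for the law of the Gaussian maximum *)

(** Independence gives a product of p factors, each at most 1 - g <= exp (- g). *)
Lemma gaussian_max_le d (T : measurableType d) (R : realType)
    (Q : probability T R) (p : nat) (Z : 'I_p -> {RV Q >-> R}) (t g : R) :
    standard_gaussian_vector Z ->
    (g%:E <= normal_prob 0%R 1%R [set x : R | (t < x)%R])%E ->
  (Q (random_row (fun j => Z j) @^-1`
        [set x : 'rV[R]_p | forall j, (x ord0 j <= t)%R]) <= (expR (- (p%:R * g)))%:E)%E.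
Proof.
move=> [Zind Zlaw] hg.
have -> : random_row (fun j => Z j) @^-1`
    [set x : 'rV[R]_p | forall j, (x ord0 j <= t)%R] =
    \bigcap_(j in [set` [set: 'I_p]%SET]) Z j @^-1` `]-oo, t]%classic.
  apply/seteqP; split => w /= h j; first by move=> _; have := h j; rewrite mxE /= in_itv /=.
  by rewrite mxE; have := h j; rewrite /= in_itv /= inE; apply.
rewrite (Zind _ (fun=> `]-oo, t]%classic)) //.
have mt := measurable_set_gt t.
have hj j : (Q (Z j @^-1` `]-oo, t]) <= (expR (- g))%:E)%E.
  rewrite -[Q _]/(distribution Q (Z j) _) Zlaw //.
  rewrite (_ : `]-oo, t]%classic = ~` [set x : R | (t < x)%R]); last first.
    by apply/seteqP; split => x /=; rewrite in_itv /= leNgt => /negP.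
  rewrite probability_setC //.
  apply: (@le_trans _ _ (1 - g%:E)%E); first exact: leeB.
  by rewrite -EFinB lee_fin; apply: expR_ge1Dx.
apply: (@le_trans _ _ (\prod_(j in [set: 'I_p]%SET) (expR (- g))%:E)%E).
  suff /andP[] : (0 <= \prod_(j in [set: 'I_p]%SET) Q (Z j @^-1` `]-oo, t]) <=
      \prod_(j in [set: 'I_p]%SET) (expR (- g))%:E)%E by [].
  apply: (big_ind2 (fun x y => 0 <= x <= y)%E) => [|x y x' y'|j _].
  - by rewrite lee01 lexx.
  - move=> /andP[x0 xy] /andP[x0' xy']; apply/andP; split; first exact: mule_ge0.
    exact: lee_pmul.
  - by rewrite measure_ge0 hj.
by rewrite prodEFin prodr_const cardsT card_ord -expRM_natl mulrN.
Qed.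

(** * Choice of the level and comparison of the two maxima *)

(** Intermediate values on [1, q] give t. Then ln q = ln t + t^2 / 2, and ln t <= t^2 / 2 since t <=
    1 + t^2 / 2. With q = c0 p, this t makes p times the lower bound of [gauss_tail_ge] equal to
    1. *)
Lemma level_exists (R : realType) (q : R) : expR 1 <= q ->
  exists t : R, [/\ 1 <= t, t * expR (t ^+ 2 / 2) = q & ln q <= t ^+ 2].
Proof.
move=> q1.
have e1 : 1 + 1 <= expR 1 :> R by exact: expR_ge1Dx.
have [t] : exists2 t, t \in `[1, q] & t * expR (t ^+ 2 / 2) = q.
  apply: IVT; first lra.
    apply: continuous_subspaceT => x.
    apply: cvgM; first exact: cvg_id.
    apply: (cvg_comp _ expR); last exact: continuous_expR.
    by apply: cvgM; [exact: sqr_continuous | exact: cvg_cst].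
  have h1 : 1 * expR (1 ^+ 2 / 2) <= q.
    by rewrite mul1r (le_trans _ q1) // ler_expR; lra.
  have h2 : q <= q * expR (q ^+ 2 / 2).
    rewrite ler_peMr; [by []|lra|].
    by rewrite (le_trans _ (expR_ge1Dx _)) // lerDl divr_ge0 ?sqr_ge0.
  by rewrite ge_min le_max h1 h2 orbT.
rewrite in_itv /= => /andP[t1 tq] tE; exists t; split => //.
have t0 : 0 < t by lra.
rewrite -tE lnM ?posrE ?expR_gt0 ?expRK //.
have : ln t <= t ^+ 2 / 2.
  rewrite -[leRHS]expRK ler_ln ?posrE ?expR_gt0 //.
  apply: le_trans (expR_ge1Dx _).
  have := sqr_ge0 (t - 1); rewrite sqrrB; lra.
lra.
Qed.

Lemma limn_esup_gt0_freq (R : realType) (u : R^nat) :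
  (0 < limn_esup (fun n => (u n)%:E))%E ->
  exists2 c : R, 0 < c & forall N, exists2 n, (N <= n)%N & c < u n.
Proof.
move=> u0.
have [c c0 cu] : exists2 c : R, 0 < c & (c%:E < limn_esup (fun n => (u n)%:E))%E.
  (* The upper limit may be infinite, in which case c = 1 serves. *)
  move: u0; case: (limn_esup _) => [r| |//].
    by rewrite lte_fin => r0; exists (r / 2); rewrite ?lte_fin; lra.
  by exists 1; rewrite ?ltry.
exists c => // N.
have /(lt_le_trans cu) : (limn_esup (fun n => (u n)%:E) <=
    ereal_sup ((fun n => (u n)%:E) @` [set n | (N <= n)%N]))%E.
  apply: ereal_inf_lbound; exists [set n | (N <= n)%N] => //.
  by exists N.
by move=> /ereal_sup_gt[_ [n /= Nn <-]]; rewrite lte_fin; exists n.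
Qed.

Lemma lee_sub_abse (R : realDomainType) (x y : R) (a b : \bar R) :
  (x%:E <= a)%E -> (0 <= b)%E -> (b <= y%:E)%E -> ((x - y)%:E <= `|a - b|)%E.
Proof.
case: a => [a| |] //; case: b => [b| |] //; rewrite ?leey //.
rewrite !lee_fin => xa _ bY; apply: le_trans (ler_norm _); lra.
Qed.

Lemma gauss_approx_error_ge (R : realType) : exists M : R,
  forall (d : measure_display) (T : measurableType d) (P : probability T R)
    (d' : measure_display) (T' : measurableType d') (Q : probability T' R)
    (n p : nat) (X : 'I_n -> 'I_p -> {RV P >-> R}) (Z : 'I_p -> {RV Q >-> R}),
  (0 < n)%N -> (0 < p)%N -> iid_rademacher X -> standard_gaussian_vector Z ->
  M * Num.sqrt n%:R <= ln p%:R ->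
  ((1 / 4)%:E <= gauss_approx_error P Q (max_sets R p)
     (self_normalized_sum (fun i j => X i j)) (random_row (fun j => Z j)))%E.
Proof.
have [c0 c0E] : exists c0 : R, c0 = normal_peak 1 * expR (- (3 / 2)) by eexists.
have c00 : 0 < c0 by rewrite c0E mulr_gt0 ?expR_gt0 ?normal_peak_gt0.
(* Since K >= 1, t^2 >= K sqrt n yields t^4 / (96 n) >= K / 96, which is what brings exp (2 - t^4 /
   (96 n)) below c0 / 8. *)
pose K : R := 96 * (2 + `|ln (8 / c0)|).
have K96 : 96 <= K by rewrite /K; have := normr_ge0 (ln (8 / c0)); lra.
(* The two extra terms absorb ln c0 in ln (c0 p) and leave a margin of 1, so that c0 p >= e as
   [level_exists] demands. *)
exists (K + `|ln c0| + 1) => d T P d' T' Q n p X Z n0 p0 Xiid Zgauss.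
set s := Num.sqrt n%:R => hM.
have s1 : 1 <= s by rewrite -sqrtr1 ler_sqrt ?ler1n // ltr0n.
have s2 : s ^+ 2 = n%:R by rewrite sqr_sqrtr.
have pR : 0 < p%:R :> R by rewrite ltr0n.
have nR : 0 < n%:R :> R by rewrite ltr0n.
have lnq : K * s + 1 <= ln (c0 * p%:R).
  rewrite lnM ?posrE //; have := ler_norm (- ln c0); rewrite normrN.
  have := normr_ge0 (ln c0); nra.
have q1 : expR 1 <= c0 * p%:R.
  rewrite -[leRHS]lnK ?posrE ?mulr_gt0 // ler_expR; nra.
have [t [t1 tE tq]] := level_exists q1.
have t0 : 0 < t by lra.
have t4 : 2 + `|ln (8 / c0)| <= t ^+ 4 / (96 * n%:R).
  rewrite ler_pdivlMr; last by rewrite mulr_gt0.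
  have Kt : K * s <= t ^+ 2 by lra.
  have : (K * s) ^+ 2 <= (t ^+ 2) ^+ 2.
    by rewrite ler_sqr ?nnegrE ?sqr_ge0 // mulr_ge0; lra.
  rewrite -exprM exprMn s2 => h.
  have : K * n%:R <= K ^+ 2 * n%:R by rewrite ler_wpM2r // expr2; nra.
  rewrite {1}/K; lra.
have small : expR (2 - t ^+ 4 / (96 * n%:R)) <= c0 / 8.
  rewrite -[leRHS]lnK ?posrE ?divr_gt0 // ler_expR.
  have -> : ln (c0 / 8) = - ln (8 / c0) by rewrite -lnV ?posrE ?divr_gt0 // invf_div.
  have := ler_norm (ln (8 / c0)); lra.
have tail : p%:R * (2 / t * expR (2 - t ^+ 2 / 2 - t ^+ 4 / (96 * n%:R))) <= 1 / 4.
  rewrite addrAC expRB.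
  have -> : p%:R * (2 / t * (expR (2 - t ^+ 4 / (96 * n%:R)) / expR (t ^+ 2 / 2))) =
     2 / c0 * (c0 * p%:R / (t * expR (t ^+ 2 / 2))) * expR (2 - t ^+ 4 / (96 * n%:R)).
    by field; rewrite !gt_eqF ?expR_gt0.
  rewrite tE divff ?mulr1; last by rewrite gt_eqF // mulr_gt0.
  rewrite -ler_pdivlMl ?divr_gt0 //; apply: le_trans small _.
  by rewrite le_eqVlt; apply/orP; left; apply/eqP; field; rewrite gt_eqF.
have hP := rademacher_max_ge n0 t0 Xiid.
have hQ := gaussian_max_le Zgauss (gauss_tail_ge t1).
have pg : p%:R * (normal_peak 1 * expR (- (3 / 2)) / t * expR (- (t ^+ 2 / 2))) = 1 :> R.
  rewrite -c0E expRN.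
  have -> : p%:R * (c0 / t / expR (t ^+ 2 / 2)) = c0 * p%:R / (t * expR (t ^+ 2 / 2)).
    by field; rewrite !gt_eqF ?expR_gt0.
  by rewrite tE divff // gt_eqF // mulr_gt0.
rewrite pg in hQ.
(* The final gap is (1 - 1/4) - 1/2 = 1/4. *)
have e1 : expR (- 1) <= 1 / 2 :> R.
  rewrite expRN -[leRHS]invrK lef_pV2 ?posrE ?expR_gt0 ?invr_gt0 //.
  by rewrite invf_div divr1; apply: le_trans (expR_ge1Dx _); lra.
apply: le_ereal_sup_tmp; eexists; first by eexists; [exists t; reflexivity | reflexivity].
apply: le_trans (lee_sub_abse hP (measure_ge0 _ _) hQ).
by rewrite lee_fin; lra.
Qed.

Unset Implicit Arguments.

Theorem proposition2p3 (R : realType) (p : nat -> nat)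
  (p_gt0 : forall n, (0 < p n)%N)
  (d : nat -> measure_display) (T : forall n, measurableType (d n))
  (P : forall n, probability (T n) R)
  (X : forall n, 'I_n -> 'I_(p n) -> {RV (P n) >-> R})
  (X_iid : forall n, iid_rademacher (X n))
  (d' : nat -> measure_display) (T' : forall n, measurableType (d' n))
  (Q : forall n, probability (T' n) R)
  (Z : forall n, 'I_(p n) -> {RV (Q n) >-> R})
  (Z_gauss : forall n, standard_gaussian_vector (Z n))
  (limsup_gt0 : (0 < limn_esup (fun n : nat =>
     ((n%:R * ln (n%:R : R)) `^ (- 2^-1) * ln ((p n)%:R : R))%:E))%E) :
  ~ ((fun n : nat => gauss_approx_error (P n) (Q n) (max_sets R (p n))
        (self_normalized_sum (fun i j => X n i j))
        (random_row (fun j => Z n j))) @ \oo --> 0%E).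
Proof.
have [c c0 hc] := limn_esup_gt0_freq limsup_gt0.
have [M hM] := gauss_approx_error_ge R.
move=> /(_ [set x | (x < (1 / 4 : R)%:E)%E]) cvg0.
have {cvg0} [] := cvg0 _.
  apply: open_nbhs_nbhs; split; first exact: open_ereal_lt_ereal.
  by rewrite /= lte_fin; lra.
move=> N0 _ hN0.
(* Beyond [N1], sqrt (ln n) exceeds |M / c|, so c sqrt (n ln n) >= M sqrt n. The absolute value
   covers any sign of M. *)
pose N1 := (Num.truncn (expR ((M / c) ^+ 2))).+1.
have [n Nn cn] := hc (maxn 2 (maxn N0 N1)).
move: Nn; rewrite !geq_max => /and3P[n2 nN0 nN1].
have n0 : (0 < n)%N by lia.
have := hN0 n nN0; rewrite /= ltNge => /negP; apply.
apply: hM => //.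
have nR : 0 < n%:R :> R by rewrite ltr0n.
have hln : (M / c) ^+ 2 < ln n%:R.
  rewrite -ltr_expR lnK ?posrE //.
  by apply: lt_le_trans (truncnS_gt _) _; rewrite ler_nat.
have lnn0 : 0 < ln n%:R :> R by apply: le_lt_trans hln; rewrite sqr_ge0.
have nl : 0 < n%:R * ln n%:R :> R by rewrite mulr_gt0.
move: cn; rewrite powRN powR12_sqrt ?(ltW nl) // sqrtrM ?(ltW nR) // mulrC.
rewrite ltr_pdivlMr ?mulr_gt0 ?sqrtr_gt0 // => cn.
apply/ltW/(le_lt_trans _ cn).
rewrite mulrCA mulrC ler_wpM2l ?sqrtr_ge0 // -ler_pdivrMl // mulrC.
apply: le_trans (ler_norm _) _.
by rewrite -sqrtr_sqr ler_wsqrtr // ltW.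
Qed.
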